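(* Let $G=(V,E=\{e_1,\dots,e_k\})$ be a loopless hypergraph with $|V|=n$ and let $A\subseteq E$. Then $$r_{\mathcal{M}(G;\mathfrak{I}^{\mathrm{B\text{-}Par\text{-}Is}})}(A)=r_{M(G)}(A),$$ where $\mathfrak{I}^{\mathrm{B\text{-}Par\text{-}Is}}$ is the boolean Parity Ising interaction family and $M(G)$ is the binary incidence matroid of $G$.
   Context: A hypergraph $G=(V,E)$ has a finite vertex set $V$ and a finite multiset $E$ of hyperedges, each a finite multiset of elements of $V$ (repeated hyperedges count as distinct elements of $E$); it is loopless if every hyperedge is a set. The boolean Parity Ising family $\mathfrak{I}^{\mathrm{B\text{-}Par\text{-}Is}}$ has spin value set $S=\mathbb{Z}/2\mathbb{Z}$ and functions $\Phi^k\colon S^k\to\{0,1\}$ with $\Phi^k(s_1,\dots,s_k)=1$ if $\sum_{i=1}^k s_i\equiv0\pmod 2$ and $0$ otherwise. The induced model $\mathcal{M}=\mathcal{M}(G;\mathfrak{I}^{\mathrm{B\text{-}Par\text{-}Is}})$ has interaction functions $\phi^e(\boldsymbol{s})=\Phi^{|e|}((s_i)_{i\in e})$ for $\boldsymbol{s}\in S^V$, $e\in E$. Its rank function is $r_{\mathcal{M}}(A)=|V|-\log_2\#\{\boldsymbol{s}\in S^V\mid\phi^e(\boldsymbol{s})=1\ \forall e\in A\}$ if this count is positive and $\infty$ otherwise, for $A\subseteq E$. The incidence matrix $B(G)$ over $\mathbb{F}_2$ is the $n\times k$ matrix whose $i$-th column is the indicator vector of $e_i$ (entry $1$ at index $j\in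 V$ if and only if $j\in e_i$). The binary incidence matroid $M(G)=(E,r_{M(G)})$ is the linear matroid represented by $B(G)$: $r_{M(G)}(A)=\dim_{\mathbb{F}_2}\operatorname{im}B(G)|_A$, where $B(G)|_A$ is the submatrix of columns indexed by $A$. *)

(* Defs.v *)
From HB Require Import structures.
From mathcomp Require Import all_boot all_order all_algebra.
From mathcomp Require Import finmap multiset.
From mathcomp Require Import reals constructive_ereal exp.

Set Implicit Arguments.
Unset Strict Implicit.
Unset Printing Implicit Defensive.

Import GRing.Theory.
Local Open Scope ring_scope.

(* The multiset of hyperedges is an indexed family, so that repeated
   hyperedges are distinct elements of [hedge]. *)
Record hypergraph := Hypergraph {
  vertex : finType;
  hedge : finType;
  ends : hedge -> {mset vertex}%mset
}.

Definition loopless (G : hypergraph) : Prop :=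
  forall (e : hedge G) (v : vertex G), (ends e v <= 1)%N.

Definition spin : finType := 'Z_2.

Definition configuration (V : finType) := {ffun V -> spin}.

(* The value set {0, 1} of boolean interactions is [bool]. *)
Definition boolean_family := forall k : nat, k.-tuple spin -> bool.

Definition B_Par_Is : boolean_family :=
  fun k (s : k.-tuple 'Z_2) => \sum_(i < k) tnth s i == 0.
Arguments B_Par_Is k s : clear implicits.

Definition boolean_model (V E : finType) := E -> configuration V -> bool.

(* Vertices are listed with multiplicity in the order of [enum_mset]; this
   order is irrelevant for families of symmetric functions. *)
Definition induced_model (G : hypergraph) (Phi : boolean_family) :
    boolean_model (vertex G) (hedge G) :=
  fun e s => Phi _ (map_tuple s (in_tuple (enum_mset (ends e)))).
Arguments induced_model G Phi e s : clear implicits.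

Section ModelRank.
Variables (R : realType) (V E : finType).

Definition log2 (x : R) : R := ln x / ln 2.

Definition satisfying (M : boolean_model V E) (A : {set E}) :
    {set configuration V} :=
  [set s | [forall e in A, M e s]].

Definition model_rank (M : boolean_model V E) (A : {set E}) : \bar R :=
  if (0 < #|satisfying M A|)%N
  then (#|V|%:R - log2 #|satisfying M A|%:R)%:E
  else +oo%E.

End ModelRank.

Definition incidence_matrix (G : hypergraph) :
    'M['F_2]_(#|vertex G|, #|hedge G|) :=
  \matrix_(j, i) (enum_val j \in ends (enum_val i))%:R.

Definition cols_of (F : fieldType) (m : nat) (E : finType)
    (B : 'M[F]_(m, #|E|)) (A : {set E}) : 'M[F]_(m, #|A|) :=
  colsub (fun i : 'I_#|A| => enum_rank (enum_val i)) B.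

(* Rank function of the linear matroid on E represented by B; the image is
   that of the map x |-> B|_A x on column vectors. *)
Definition linear_matroid_rank (F : fieldType) (m : nat) (E : finType)
    (B : 'M[F]_(m, #|E|)) (A : {set E}) : nat :=
  \dim (limg (linfun (mulmx (cols_of B A) : 'cV[F]_#|A| -> 'cV[F]_m))).

Definition incidence_matroid_rank (G : hypergraph) (A : {set hedge G}) : nat :=
  linear_matroid_rank (incidence_matrix G) A.
Arguments incidence_matroid_rank G A : clear implicits.

(* Main.v *)
Require Import Defs.
From mathcomp Require Import all_boot all_order all_algebra.
From mathcomp Require Import finmap multiset mxabelem.
From mathcomp Require Import reals constructive_ereal exp.

(** The parity constraint of a hyperedge asks that the spins on its vertices
    sum to zero, which is a linear equation over F_2; on a set hyperedge its
    coefficient vector is the indicator of the hyperedge, that is, a column of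
    the incidence matrix ([induced_B_Par_IsE]).  Hence the configurations that
    satisfy all constraints in [A] are exactly the left kernel of the submatrix
    of columns in [A].  By rank-nullity this kernel has 2 ^ (n - r) elements,
    where n is the number of vertices and r the rank of the submatrix
    ([card_left_kernel], [card_satisfying]).  The count is positive, so the
    model rank is n - log2 (2 ^ (n - r)) = r.  The matroid rank is by definition
    the dimension of the column image; [dim_limg_mulmx] identifies it with the
    matrix rank, which rank-nullity speaks of.

    A loop would spoil this: a vertex occurring twice in a hyperedge cancels
    in the parity sum but still contributes a 1 to the incidence matrix. *)

Import GRing.Theory Num.Theory.
Local Open Scope ring_scope.

(** Full-rank factorization: write [C] as [col_base C *m row_base C].  The
    right factor acts surjectively, so it does not change the image; the left
    factor acts injectively on a space of dimension [\rank C]. *)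
Lemma dim_limg_mulmx (F : fieldType) (m n : nat) (C : 'M[F]_(m, n)) :
  (\dim (limg (linfun (mulmx C : 'cV[F]_n -> 'cV[F]_m))) = \rank C)%N.
Proof.
pose f r (P : 'M[F]_(m, r)) := linfun (mulmx P : 'cV[F]_r -> 'cV[F]_m).
have fE r (P : 'M[F]_(m, r)) x : f r P x = P *m x by rewrite lfunE.
have -> : limg (linfun (mulmx C : 'cV[F]_n -> 'cV[F]_m))
  = limg (f _ (col_base C)).
  apply/vspaceP => v; apply/memv_imgP/memv_imgP => -[x _ ->].
    exists (row_base C *m x); first exact: memvf.
    by rewrite fE lfunE /= mulmxA mulmx_base.
  exists (pinvmx (row_base C) *m x); first exact: memvf.
  have baseE : C *m pinvmx (row_base C) = col_base C.
    have := congr1 (mulmx^~ (pinvmx (row_base C))) (mulmx_base C).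
    by rewrite /= -mulmxA mulmxVp ?row_base_free // mulmx1.
  by rewrite fE lfunE /= mulmxA baseE.
rewrite limg_dim_eq; first by rewrite dimvf /dim /= muln1.
rewrite capfv; apply/eqP/lker0P => x y; rewrite !fE.
suff inj : injective (mulmx (col_base C) : 'cV[F]_(\rank C) -> 'cV[F]_m).
  exact: inj.
apply: (can_inj (g := mulmx (pinvmx (col_base C)))) => z.
by rewrite mulmxA mulVpmx ?col_base_full // mul1mx.
Qed.

(** Rank-nullity in counting form: the left kernel is the row space of
    [kermx C], which has dimension [m - \rank C]. *)
Lemma card_left_kernel (F : finFieldType) (m n : nat) (C : 'M[F]_(m, n)) :
  #|[set u : 'rV[F]_m | u *m C == 0]| = (#|F| ^ (m - \rank C))%N.
Proof.
rewrite -mxrank_ker -card_rowg; apply: eq_card => u.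
by rewrite mem_rowg inE sub_kermx.
Qed.

(** Looplessness turns the sum over the listed vertices, taken with
    multiplicity, into a sum over the underlying set. *)
Lemma induced_B_Par_IsE (G : hypergraph) (e : hedge G)
    (s : configuration (vertex G)) : loopless G ->
  induced_model G B_Par_Is e s = (\sum_(v in ends e) s v == 0).
Proof.
move=> loopG; rewrite /induced_model /B_Par_Is.
have uniq_e : uniq (enum_mset (ends e)).
  apply: count_mem_uniq => v; rewrite count_mem_mset -has_pred1 has_count.
  by rewrite count_mem_mset; case: (ends e v) (loopG e v) => [|[]].
congr (_ == 0).
transitivity (\sum_(v <- map s (enum_mset (ends e))) v).
  pose t := map_tuple s (in_tuple (enum_mset (ends e))).
  exact/esym/(big_tuple _ _ t predT id).
by rewrite big_map big_uniq //; apply: eq_bigl.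
Qed.

(** Reading a configuration as a row vector over F_2, via the enumeration of
    the vertices, identifies the satisfying configurations with a left
    kernel. *)
Lemma card_satisfying (G : hypergraph) (A : {set hedge G}) : loopless G ->
  #|satisfying (induced_model G B_Par_Is) A|
  = (2 ^ (#|vertex G| - incidence_matroid_rank G A))%N.
Proof.
move=> loopG; rewrite /incidence_matroid_rank /linear_matroid_rank.
(* Spins live in 'Z_2, the matrix in 'F_2; the two types are convertible. *)
rewrite dim_limg_mulmx -[X in (X ^ _)%N](card_Fp (isT : prime 2)).
rewrite -card_left_kernel.
pose row_of (s : configuration (vertex G)) : 'rV['F_2]_#|vertex G| :=
  \row_j (s (enum_val j) : 'F_2).
have row_of_bij : bijective row_of.
  exists (fun u : 'rV['F_2]_#|vertex G| =>
    [ffun v => (u 0 (enum_rank v) : 'F_2) : spin]).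
    by move=> s; apply/ffunP => v; rewrite ffunE mxE enum_rankK.
  by move=> u; apply/rowP => j; rewrite mxE ffunE enum_valK.
rewrite -[RHS](on_card_preimset (onW_bij _ row_of_bij)); apply: eq_card => s.
have edgeE (i : 'I_#|A|) :
    (row_of s *m cols_of (incidence_matrix G) A) 0 i
    = \sum_(v in ends (enum_val i)) s v.
  rewrite mxE (reindex (enum_rank : vertex G -> _)) /=; last first.
    by apply: onW_bij; exact: enum_rank_bij.
  rewrite [RHS]big_mkcond; apply: eq_bigr => v _.
  rewrite !mxE !enum_rankK.
  by case: ifP => _; rewrite ?mulr1 ?mulr0.
rewrite !inE; apply/forall_inP/eqP => [sat|ker0 e eA].
  apply/rowP => i; rewrite edgeE mxE; apply/eqP.
  by have := sat _ (enum_valP i); rewrite induced_B_Par_IsE.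
rewrite induced_B_Par_IsE // -(enum_rankK_in eA eA) -edgeE.
by rewrite ker0 mxE.
Qed.

Lemma log2_exp2 (R : realType) (k : nat) : log2 (2 ^ k)%:R = k%:R :> R.
Proof.
rewrite /log2 natrX lnXn ?ltr0n // mulrnAl divff //.
by rewrite lt0r_neq0 // ln_gt0 // ltr1n.
Qed.

(** Needed because the exponent in [card_satisfying] is a truncated
    difference. *)
Lemma incidence_matroid_rank_le (G : hypergraph) (A : {set hedge G}) :
  (incidence_matroid_rank G A <= #|vertex G|)%N.
Proof.
rewrite /incidence_matroid_rank /linear_matroid_rank dim_limg_mulmx.
exact: rank_leq_row.
Qed.

Theorem proposition5p9 (R : realType) (G : hypergraph) (A : {set hedge G}) :
  loopless G ->
  model_rank R (induced_model G B_Par_Is) A =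
  ((incidence_matroid_rank G A)%:R)%:E.
Proof.
move=> loopG; rewrite /model_rank card_satisfying // expn_gt0 /= log2_exp2.
by rewrite natrB ?incidence_matroid_rank_le // subKr.
Qed.
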